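(* Let $\mathcal{F}(q)=\sum_{n\ge 0} b(n)q^n$ be the ordinary generating function of block-separated overpartitions. Then, as formal power series in $q$, $$\mathcal{F}(q)=\sum_{r\ge 0} F_{r+2}\, e_r\bigl(S_1(q),S_2(q),S_3(q),\dots\bigr),$$ where $F_m$ denotes the $m$-th Fibonacci number, $S_j(q)=\frac{q^j}{1-q^j}$ for $j\ge 1$, and $e_r$ is the $r$-th elementary symmetric function $$e_r(x_1,x_2,\dots)=\sum_{1\le i_1<i_2<\cdots<i_r} x_{i_1}x_{i_2}\cdots x_{i_r},\qquad e_0=1.$$
   Context: A partition of $n$ is written in block form $(d_1^{m_1},\dots,d_r^{m_r})$ with $d_1>d_2>\cdots>d_r\ge 1$, multiplicities $m_i\ge 1$, and $\sum_i m_i d_i=n$. An overpartition of $n$ is a partition of $n$ in which the first occurrence of each distinct part may optionally be overlined; let $x_i\in\{0,1\}$ equal $1$ if and only if the first occurrence in the block $d_i^{m_i}$ is overlined. An overpartition is block-separated if no two consecutive distinct blocks are both overlined, i.e. $x_i x_{i+1}=0$ for all $i=1,\dots,r-1$. $b(n)$ is the number of block-separated overpartitions of $n$, with $b(0)=1$ (the empty overpartition). The Fibonacci numbers are $F_0=0$, $F_1=1$, $F_n=F_{n-1}+F_{n-2}$ for $n\ge 2$. For $j\ge1$, $S_j(q)=\sum_{m\ge 1}q^{jm}=\frac{q^j}{1-q^j}$. *)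

(* Defs.v *)
From HB Require Import structures.
From mathcomp Require Import all_boot all_order all_algebra finmap.
From mathcomp Require Import boolp classical_sets functions cardinality fsbigop.

Set Implicit Arguments.
Unset Strict Implicit.
Unset Printing Implicit Defensive.
Import GRing.Theory.
Local Open Scope classical_set_scope.
Local Open Scope ring_scope.

(* The ring of formal power series R[[q]]; [f n] is the coefficient of q^n. *)

Record fps (R : Type) := FPS { fps_coef :> nat -> R }.

Lemma fpsP (R : Type) (f g : fps R) : (forall n, f n = g n) -> f = g.
Proof. by case: f g => [f] [g] /= fg; congr FPS; apply/funext. Qed.

HB.instance Definition _ (R : Type) := gen_eqMixin (fps R).
HB.instance Definition _ (R : Type) := gen_choiceMixin (fps R).

Section FpsRing.
Variable R : comNzRingType.
Implicit Types f g h : fps R.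

Definition fps_zero : fps R := FPS (fun=> 0).
Definition fps_one : fps R := FPS (fun n => (n == 0%N)%:R).
Definition fps_add f g : fps R := FPS (fun n => f n + g n).
Definition fps_opp f : fps R := FPS (fun n => - f n).
Definition fps_mul f g : fps R := FPS (fun n => \sum_(i < n.+1) f i * g (n - i)%N).

Let addA : associative fps_add.
Proof. by move=> f g h; apply: fpsP => n /=; rewrite addrA. Qed.
Let addC : commutative fps_add.
Proof. by move=> f g; apply: fpsP => n /=; rewrite addrC. Qed.
Let add0 : left_id fps_zero fps_add.
Proof. by move=> f; apply: fpsP => n /=; rewrite add0r. Qed.
Let addN : left_inverse fps_zero fps_opp fps_add.
Proof. by move=> f; apply: fpsP => n /=; rewrite addNr. Qed.

HB.instance Definition _ := GRing.isZmodule.Build (fps R) addA addC add0 addN.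

Let trunc n f : {poly R} := \poly_(i < n.+1) f i.

Let coef_trunc n f i : (i <= n)%N -> (trunc n f)`_i = f i.
Proof. by rewrite coef_poly ltnS => ->. Qed.

Let mulE n m f g : (n <= m)%N -> fps_mul f g n = (trunc m f * trunc m g)`_n.
Proof.
move=> nm; rewrite coefM; apply: eq_bigr => i _.
by rewrite !coef_trunc// ?(leq_trans (leq_subr _ _))// (leq_trans _ nm)// -ltnS.
Qed.

Let mulC : commutative fps_mul.
Proof. by move=> f g; apply: fpsP => n; rewrite !(mulE _ _ (leqnn n)) mulrC. Qed.
Let mulA : associative fps_mul.
Proof.
suff E f g h n : fps_mul (fps_mul f g) h n = (trunc n f * trunc n g * trunc n h)`_n.
  by move=> f g h; apply: fpsP => n; rewrite (mulC f) !E mulrC mulrA.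
rewrite /fps_mul/= coefM; apply: eq_bigr => i _.
by rewrite (coef_trunc h) ?leq_subr// -(mulE f g (_ : i <= n)%N)// -ltnS.
Qed.
Let mul1 : left_id fps_one fps_mul.
Proof.
move=> f; apply: fpsP => n /=; rewrite big_ord_recl/= mul1r subn0.
by rewrite big1 ?addr0// => i _; rewrite mul0r.
Qed.
Let mulDl : left_distributive fps_mul fps_add.
Proof.
move=> f g h; apply: fpsP => n /=; rewrite -big_split/=.
by apply: eq_bigr => i _; rewrite mulrDl.
Qed.
Let one_neq0 : fps_one != fps_zero.
Proof. by apply/eqP => /(congr1 (@^~ 0%N \o @fps_coef R))/= /eqP; rewrite oner_eq0. Qed.

HB.instance Definition _ :=
  GRing.Zmodule_isComNzRing.Build (fps R) mulA mulC mul1 mulDl one_neq0.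

(* As usual in unit rings, the inverse of a non-invertible series is itself. *)
Definition fps_unit : {pred fps R} := [pred f | `[< exists g, g * f = 1 >]].
Definition fps_inv f : fps R :=
  if pselect (exists g, g * f = 1) is left ex then sval (cid ex) else f.

Let mulVf : {in fps_unit, left_inverse 1 fps_inv *%R}.
Proof.
move=> f /asboolP ex; rewrite /fps_inv.
by case: pselect => [ex'|/(_ ex)//]; case: (cid ex').
Qed.
Let unitPl f g : g * f = 1 -> fps_unit f.
Proof. by move=> gf; apply/asboolP; exists g. Qed.
Let inv_out : {in [predC fps_unit], fps_inv =1 id}.
Proof.
move=> f /asboolP nex; rewrite /fps_inv.
by case: pselect.
Qed.

HB.instance Definition _ :=
  GRing.ComNzRing_hasMulInverse.Build (fps R) mulVf unitPl inv_out.

Definition fps_q : fps R := FPS (fun n => (n == 1%N)%:R).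

Lemma fps_qXE k n : (fps_q ^+ k) n = (n == k)%:R.
Proof.
elim: k n => [|k IH] n; first by rewrite expr0.
rewrite exprS; change (fps_mul fps_q (fps_q ^+ k) n = (n == k.+1)%:R).
rewrite /=; case: n => [|n]; first by rewrite big_ord1 mul0r.
rewrite !big_ord_recl/= mul0r add0r mul1r IH subSS subn0 big1 ?addr0//.
by move=> i _; rewrite mul0r.
Qed.

(* Infinite sums in R[[q]]: a family is summable when each power of q occurs
   in only finitely many of its members, and is then summed coefficientwise.
   The value of [fps_sum] on a non-summable family is irrelevant. *)
Definition fps_summable (I : choiceType) (A : set I) (f : I -> fps R) :=
  forall n, finite_set [set i | A i /\ f i n != 0].
Definition fps_sum (I : choiceType) (A : set I) (f : I -> fps R) : fps R :=
  FPS (fun n => \sum_(i \in A) f i n).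

(* For x indexed by the integers j >= 1 (x 0 is ignored), e_r(x_1, x_2, ...) is
   the sum over the tuples 1 <= i_1 < ... < i_r. *)
Definition elem_sym_index (r : nat) : set (r.-tuple nat) :=
  [set t : r.-tuple nat | all (leq 1) t && sorted ltn t].
Definition elem_sym_term (x : nat -> fps R) (r : nat) (t : r.-tuple nat) : fps R :=
  \prod_(k < r) x (tnth t k).
Definition elem_sym (r : nat) (x : nat -> fps R) : fps R :=
  fps_sum (@elem_sym_index r) (@elem_sym_term x r).

Definition S_ (j : nat) : fps R := fps_q ^+ j / (1 - fps_q ^+ j).

Let fps_mulqX f k n :
  (f * fps_q ^+ k) n = if (k <= n)%N then f (n - k)%N else 0.
Proof.
change (\sum_(i < n.+1) f i * (fps_q ^+ k) (n - i)%N = if (k <= n)%N then f (n - k)%N else 0).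
under eq_bigr do rewrite fps_qXE mulr_natr mulrb.
rewrite -big_mkcond/=; case: ifPn => [kn|]; last first.
  rewrite -ltnNge => nk; rewrite big_pred0// => i.
  by apply: ltn_eqF; rewrite (leq_ltn_trans _ nk)// leq_subr.
rewrite (big_pred1 (inord (n - k)))/= => [|i].
  by rewrite inordK// ltnS leq_subr.
have ni : (i <= n)%N by rewrite -ltnS.
apply/eqP/eqP => [<-|->]; first by apply: val_inj; rewrite /= subKn// inordK.
by rewrite inordK ?ltnS ?leq_subr// subKn.
Qed.

Let geom j : (0 < j)%N -> FPS (fun n => (j %| n)%:R) * (1 - fps_q ^+ j) = 1.
Proof.
move=> j0; rewrite mulrBr mulr1; apply: fpsP => n.
rewrite [LHS](_ : _ = (j %| n)%:R - (FPS (fun n => (j %| n)%:R) * fps_q ^+ j) n)//.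
rewrite fps_mulqX [RHS](_ : _ = (n == 0%N)%:R)//=; case: ifPn => [jn|].
  by rewrite dvdn_subl// subrr gtn_eqF// (leq_trans j0).
rewrite -ltnNge subr0; case: n => [|n] nj; first by rewrite dvdn0.
by rewrite gtnNdvd.
Qed.

Lemma unit_1subqX j : (0 < j)%N -> 1 - fps_q ^+ j \is a GRing.unit.
Proof. by move=> /geom; exact: unitPl. Qed.

Lemma S_E j : (0 < j)%N ->
  S_ j = fps_sum [set m | (1 <= m)%N] (fun m => fps_q ^+ (j * m)).
Proof.
move=> j0; rewrite /S_.
have -> : (1 - fps_q ^+ j)^-1 = FPS (fun n => (j %| n)%:R).
  by apply: (mulIr (unit_1subqX j0)); rewrite mulVr ?unit_1subqX ?geom.
apply: fpsP => n; rewrite mulrC fps_mulqX/=.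
under eq_fsbigr do rewrite fps_qXE.
case: ifPn => [jn|]; last first.
  rewrite -ltnNge => nj; rewrite fsbig1// => m /= m1.
  by rewrite ltn_eqF// (leq_trans nj)// leq_pmulr.
rewrite dvdn_subl//; case: (boolP (j %| n)%N) => [/dvdnP[m nE]|njn].
  rewrite -(@fsbig_widen _ _ _ _ [set m]) ?fsbig_set1.
  - by rewrite nE mulnC eqxx.
  - by move=> _ /= ->; move: jn; rewrite nE; case: m {nE} => //; rewrite mul0n leqNgt j0.
  - move=> k /= [_ /eqP km]; rewrite nE [(m * j)%N]mulnC eqn_pmul2l//.
    by rewrite eq_sym (negbTE km).
rewrite fsbig1// => m _; case: eqP => // nE.
by rewrite nE dvdn_mulr in njn.
Qed.

End FpsRing.

Arguments elem_sym_index r _ : clear implicits.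
Arguments elem_sym_term {R} x r t.

Fixpoint fib (n : nat) : nat :=
  match n with
  | 0 => 0
  | 1 => 1
  | (m.+1 as k).+1 => fib k + fib m
  end%N.

(* A block d^m of a partition, with a flag telling whether its first part is
   overlined. *)
Record block := Block { part : nat; mult : nat; overlined : bool }.

Definition block_tuple B := (part B, mult B, overlined B).
Definition tuple_block t := Block t.1.1 t.1.2 t.2.
Lemma block_tupleK : cancel block_tuple tuple_block. Proof. by case. Qed.
HB.instance Definition _ := Countable.copy block (can_type block_tupleK).

(* An overpartition is given by its block form, listed by decreasing parts. *)
Definition overpartition (n : nat) (s : seq block) : bool :=
  [&& sorted gtn (map part s),
      all (fun B => (1 <= part B) && (1 <= mult B)) s
    & \sum_(B <- s) mult B * part B == n]%N.

Definition block_separated (s : seq block) : bool :=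
  sorted (fun B C => ~~ (overlined B && overlined C)) s.

Definition separated_overpartitions (n : nat) : set (seq block) :=
  [set s | overpartition n s && block_separated s].

Lemma finite_separated_overpartitions n :
  finite_set (separated_overpartitions n).
Proof.
pose F (t : n.-bseq ('I_n.+1 * 'I_n.+1 * bool)) :=
  [seq Block (nat_of_ord x.1.1) (nat_of_ord x.1.2) x.2 | x <- t].
apply: (@sub_finite_set _ _ (F @` setT)); last exact: finite_image.
move=> s /= /andP[/and3P[_ pos /eqP sumE] _].
have bnd : {in s, forall B, (part B <= n)%N && (mult B <= n)%N}.
  move=> B Bs; have /andP[p1 m1] := allP pos _ Bs.
  have le : (mult B * part B <= n)%N.
    by rewrite -sumE (big_rem B)//= leq_addr.
  by rewrite (leq_trans _ le) ?leq_pmull//= (leq_trans _ le)// leq_pmulr.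
have sz : (size s <= n)%N.
  rewrite -sumE -sum1_size big_seq [leqRHS]big_seq; apply: leq_sum => B Bs.
  by have /andP[p1 m1] := allP pos _ Bs; rewrite muln_gt0 p1 m1.
pose G B : 'I_n.+1 * 'I_n.+1 * bool :=
  (inord (part B), inord (mult B), overlined B).
have szG : (size (map G s) <= n)%N by rewrite size_map.
exists (Bseq szG) => //; rewrite /F/= -map_comp -[RHS]map_id.
apply/eq_in_map => -[p m o] /bnd/= /andP[pn mn].
by rewrite /= !inordK.
Qed.

Definition num_separated (n : nat) : nat :=
  #|` fset_set (separated_overpartitions n)|.

Lemma num_separated0 : num_separated 0 = 1%N.
Proof.
rewrite /num_separated (_ : separated_overpartitions 0 = [set [::]]) ?fset_set1 ?cardfs1//.
apply/seteqP; split=> s /=; last first.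
  by move=> ->; rewrite /separated_overpartitions/= /overpartition big_nil.
case: s => // -[p m o] s /andP[/and3P[_ /= /andP[/andP[p0 m0] _]]].
by rewrite big_cons addn_eq0 muln_eq0/= !eqn0Ngt p0 m0.
Qed.

Definition separated_gf : fps int := FPS (fun n => (num_separated n)%:R).

(* Main.v *)
(* Group the overpartitions of n by their set of distinct parts u.  For fixed u
   with r elements, the multiplicities and the overlines are chosen
   independently: the former contribute the coefficient of q^n in
   \prod_(j in u) S_j, the latter the number F_(r+2) of binary words of length r
   without two adjacent ones.  As F_(r+2) > 0, that coefficient vanishes unless
   u comes from one of the finitely many overpartitions of n, whence also the
   summability statements. *)
Require Import Defs.
From mathcomp Require Import all_boot all_order all_algebra finmap.
From mathcomp Require Import boolp classical_sets functions cardinality fsbigop.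
Local Open Scope classical_set_scope.
Local Open Scope ring_scope.
Import GRing.Theory Num.Theory.

Lemma fps_coef1 (R : comNzRingType) n : (1 : fps R) n = (n == 0%N)%:R.
Proof. by []. Qed.

Lemma fps_coefM (R : comNzRingType) (f g : fps R) n :
  (f * g) n = \sum_(i < n.+1) f i * g (n - i)%N.
Proof. by []. Qed.

Lemma fps_coefMn (R : comNzRingType) (f : fps R) k n : (f *+ k) n = f n *+ k.
Proof. by elim: k => // k IH; rewrite !mulrS -IH. Qed.

Lemma coef_S (R : comNzRingType) j n : (0 < j)%N ->
  S_ R j n = ((0 < n)%N && (j %| n)%N)%:R.
Proof.
move=> j0; rewrite S_E//=.
under eq_fsbigr do rewrite fps_qXE.
case: (boolP (_ && _)) => [/andP[n0 /dvdnP[m nE]]|jn]; last first.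
  rewrite fsbig1// => m /= m0; case: eqP => // nE; move: jn.
  by rewrite nE muln_gt0 j0 m0 dvdn_mulr.
(* The equation n = j * k has the single solution k = m. *)
rewrite -(@fsbig_widen _ _ _ _ [set m]) ?fsbig_set1.
- by rewrite nE mulnC eqxx.
- by move=> _ /= ->; move: n0; rewrite nE muln_gt0 => /andP[].
- move=> k /= [_ /eqP km]; rewrite nE [(m * j)%N]mulnC eqn_pmul2l//.
  by rewrite eq_sym (negbTE km).
Qed.

(** * Lists of blocks with prescribed parts *)

Definition weight (s : seq block) : nat := (\sum_(B <- s) mult B * part B)%N.

(** The dummy block [Block 0 0 b] only carries the flag of the preceding block; [b = false]
    constrains nothing, which recovers [block_separated]. *)
Definition separated_after (b : bool) (s : seq block) : bool :=
  path (fun B C => ~~ (overlined B && overlined C)) (Block 0 0 b) s.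

Lemma separated_after_cons b B s :
  separated_after b (B :: s) =
  ~~ (b && overlined B) && separated_after (overlined B) s.
Proof. by case: s. Qed.

(* [b] tells whether the block standing before the list is overlined; the
   blocks with part [j] are indexed by their total contribution [i = m * j]. *)
Fixpoint blocks_with_parts (b : bool) (t : seq nat) (n : nat) : seq (seq block) :=
  if t is j :: t' then
    [seq Block j (x.1 %/ j) x.2 :: s |
       x <- [seq (i, o) | i <- [seq i <- iota 1 n | (j %| i)%N],
                          o <- if b then [:: false] else [:: false; true]],
       s <- blocks_with_parts x.2 t' (n - x.1)]
  else if n == 0%N then [:: [::]] else [::].

(** Soundness and completeness of the enumeration; with [uniq_blocks_with_parts], its size becomes a
    count. *)
Lemma mem_blocks_with_parts b t n s : all (leq 1) t ->
  (s \in blocks_with_parts b t n) =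
  [&& map part s == t, all (fun B => 1 <= mult B)%N s, weight s == n
    & separated_after b s].
Proof.
rewrite /weight; elim: t b n s => [|j t IH] b n s /=.
  move=> _; case: s => [|B s]; rewrite ?big_nil; last by case: ifP.
  by rewrite eq_sym; case: ifP.
move=> /andP[j0 t0]; apply/allpairsPdep/idP => [[[i o] [s' []]]|].
  case/allpairsPdep => i' [o' [+ + [ii oo]]]; rewrite -{}ii -{}oo {i' o'}.
  rewrite mem_filter mem_iota add1n ltnS => /andP[ji /andP[i0 ni]] ob.
  rewrite IH// => /and4P[/eqP tE m0 /eqP wE sep] ->.
  rewrite /= tE eqxx m0 big_cons /= wE divnK// subnKC// eqxx /=.
  rewrite divn_gt0// dvdn_leq//=.
  by rewrite separated_after_cons sep andbT; case: (b) (o) ob => [] [].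
case: s => [//|[p m o] s] /= /and4P[/eqP[-> tE] /andP[m0 ms] /eqP wE].
rewrite separated_after_cons => /andP[ob sep].
exists ((m * j)%N, o), s; move: wE; rewrite big_cons/= => <-; split.
- apply/allpairsPdep; exists (m * j)%N, o; split => //.
    by rewrite mem_filter mem_iota muln_gt0 m0 j0 dvdn_mull//= add1n ltnS leq_addr.
  by case: (b) (o) ob => [] [].
- by rewrite IH//= tE eqxx ms addKn eqxx.
- by rewrite mulnK.
Qed.

Lemma uniq_blocks_with_parts b t n : all (leq 1) t ->
  uniq (blocks_with_parts b t n).
Proof.
elim: t b n => [|j t IH] b n /=; first by case: ifP.
move=> /andP[j0 t0]; apply: allpairs_uniq_dep.
- apply: allpairs_uniq_dep => /=; first exact/filter_uniq/iota_uniq.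
  + by case: b.
  + by move=> [i o] [i' o'] _ _ /= [-> ->].
- by move=> x _; apply: IH.
- move=> [x s] [y s'] /= /allpairsPdep[x0 [s0 [xI _ ex]]].
  case: ex xI => <- _ xI.
  move=> /allpairsPdep[y0 [s1 [yI _ ey]]]; case: ey yI => <- _ yI [].
  move: xI yI; case/allpairsPdep=> i [o [+ _ ->]] /allpairsPdep[i' [o' [+ _ ->]]] /=.
  rewrite !mem_filter => /andP[ji _] /andP[ji' _].
  (* Since [j] divides both totals, equal quotients give equal totals. *)
  by move=> ii -> ->; rewrite -(divnK ji) ii divnK.
Qed.

(* The first block is free to be overlined unless the preceding one is: the
   recursion is that of the Fibonacci numbers, shifted by one if [b]. *)
Lemma size_blocks_with_parts b t n : all (leq 1) t ->
  (size (blocks_with_parts b t n))%:R =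
  (fib (if b then (size t).+1 else (size t).+2))%:R
    * (\prod_(j <- t) S_ int j) n.
Proof.
elim: t b n => [|j t IH] b n /=.
  by rewrite big_nil fps_coef1; case: b; case: ifP.
move=> /andP[j0 t0]; rewrite big_cons fps_coefM size_allpairs_dep.
rewrite -(big_mkord xpredT (fun i => S_ int j i * (\prod_(j <- t) S_ int j) (n - i)%N)).
(* S_j has no constant term, so the convolution starts at 1, as the enumeration does. *)
rewrite big_ltn// coef_S// mul0r add0r /index_iota subn1.
rewrite sumnE big_map natr_sum big_allpairs_dep big_filter mulr_sumr big_mkcond.
apply: eq_big_seq => i; rewrite mem_iota => /andP[i0 _].
rewrite coef_S// i0; case: ifP => _; last by rewrite mul0r mulr0.
rewrite mul1r; case: b; rewrite ?big_cons big_nil /= !IH//= ?addr0//.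
by rewrite -mulrDl -natrD.
Qed.

(** * Separated overpartitions grouped by their distinct parts *)

Definition increasing_pos (u : seq nat) : bool := all (leq 1) u && sorted ltn u.

(** Reversed because block forms list parts decreasingly, while the tuples of [elem_sym_index]
    increase. *)
Definition parts_of (s : seq block) : seq nat := rev (map part s).

Lemma separated_overpartitionsE n s :
  (s \in separated_overpartitions n) =
  increasing_pos (parts_of s)
    && (s \in blocks_with_parts false (rev (parts_of s)) n).
Proof.
have -> : (s \in separated_overpartitions n) = overpartition n s && block_separated s.
  by apply/idP/idP; rewrite inE.
rewrite /overpartition /increasing_pos /parts_of revK all_rev rev_sorted.
rewrite (_ : all _ s = all (leq 1) (map part s) && all (fun B => 1 <= mult B)%N s).
  rewrite (_ : block_separated s = separated_after false s); last by case: s.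
  case: (boolP (all (leq 1) (map part s))) => [s0|]; last by rewrite andbF.
  by rewrite mem_blocks_with_parts// eqxx -!andbA.
by rewrite all_map -all_predI; apply: eq_all => B.
Qed.

(** The fibre of [parts_of] over [u] is, up to order, [blocks_with_parts false (rev u) n], and
    reversing [u] changes neither its size nor the product. *)
Lemma size_parts_fiber n u : increasing_pos u ->
  (size [seq s <- fset_set (separated_overpartitions n) | parts_of s == u])%:R =
  (fib (size u).+2)%:R * (\prod_(j <- u) S_ int j) n.
Proof.
move=> u0; have r0 : all (leq 1) (rev u) by rewrite all_rev; case/andP: u0.
rewrite -(perm_big _ (permEl (perm_rev u))) -{1}(size_rev u).
rewrite -(size_blocks_with_parts false)//; congr _%:R.
apply/perm_size/uniq_perm; first exact/filter_uniq/fset_uniq.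
  exact: uniq_blocks_with_parts.
move=> s; rewrite mem_filter in_fset_set; last exact: finite_separated_overpartitions.
rewrite separated_overpartitionsE; case: eqP => [->|su]; first by rewrite u0.
(* Membership on the right would force [map part s] to be [rev u]. *)
by rewrite mem_blocks_with_parts// -(can_eq revK) (revK u); case: eqP.
Qed.

Lemma parts_of_separated n s :
  s \in fset_set (separated_overpartitions n) -> increasing_pos (parts_of s).
Proof.
rewrite in_fset_set; last exact: finite_separated_overpartitions.
by rewrite separated_overpartitionsE => /andP[].
Qed.

Definition separated_parts (n : nat) : {fset seq nat} :=
  [fset parts_of s | s in fset_set (separated_overpartitions n)]%fset.

Lemma separated_parts_increasing n u :
  u \in separated_parts n -> increasing_pos u.
Proof. by move=> /imfsetP[s /= sn ->]; exact: parts_of_separated sn. Qed.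

(** The fibre over [u] is empty, so F_(r+2) times the coefficient is 0. *)
Lemma coef_prod_S_eq0 n u : increasing_pos u -> u \notin separated_parts n ->
  (\prod_(j <- u) S_ int j) n = 0.
Proof.
move=> u0 uP; have /eqP := size_parts_fiber n u u0.
rewrite (_ : [seq _ <- _ | _] = [::]); last first.
  apply/eqP; rewrite -[_ == _]negbK -has_filter; apply: contra uP.
  by move=> /hasP[s sn /eqP <-]; apply/imfsetP; exists s.
rewrite eq_sym mulf_eq0 pnatr_eq0 => /orP[/eqP|/eqP//].
(* The recursion would carry a zero F_(r+2) down to F_2 = 1. *)
by elim: (size u) => //= r IH /eqP; rewrite addn_eq0 => /andP[/eqP/IH].
Qed.

Lemma num_separatedE n :
  (num_separated n)%:R =
  \sum_(u <- separated_parts n) (fib (size u).+2)%:R * (\prod_(j <- u) S_ int j) n.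
Proof.
rewrite /num_separated -sum1_size (partition_big_imfset _ parts_of) natr_sum /=.
apply: eq_big_seq => u /separated_parts_increasing u0.
by rewrite -size_parts_fiber// size_filter -sum1_count.
Qed.

(** * Coefficients of the elementary symmetric functions *)

Lemma elem_sym_termE r (t : r.-tuple nat) :
  elem_sym_term (S_ int) r t = \prod_(j <- t) S_ int j.
Proof. by rewrite /elem_sym_term big_tuple. Qed.

(** Tuples outside [separated_parts n] contribute 0, so the infinite sum becomes finite, over one
    set that serves all r. *)
Lemma coef_elem_sym_S r n :
  elem_sym r (S_ int) n =
  \sum_(u <- separated_parts n | size u == r) (\prod_(j <- u) S_ int j) n.
Proof.
pose P := [pred u | increasing_pos u && (size u == r)].
transitivity (\sum_(u <- separated_parts n | P u) (\prod_(j <- u) S_ int j) n).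
  rewrite bigfs; [|exact: fset_uniq|]; last first.
    by move=> u /andP[u0 _]; exact: coef_prod_S_eq0.
  rewrite (reindex_fsbig (@tval r nat) (elem_sym_index r)).
    by apply: eq_fsbigr => t _; rewrite elem_sym_termE.
  split.
  - by move=> t ti; apply/andP; split => //; rewrite size_tuple.
  - by move=> x y _ _; exact: val_inj.
  - by move=> u /= /andP[u0 ur]; exists (Tuple ur).
rewrite big_seq_cond [RHS]big_seq_cond; apply: eq_bigl => u /=.
by case: (boolP (u \in _)) => // /separated_parts_increasing ->.
Qed.

Theorem theorem1 :
  [/\ forall r : nat,
        fps_summable (elem_sym_index r) (elem_sym_term (S_ int) r),
      fps_summable [set: nat]
        (fun r : nat => (fib r.+2)%:R * elem_sym r (S_ int))
    & separated_gf =
      fps_sum [set: nat] (fun r : nat => (fib r.+2)%:R * elem_sym r (S_ int))].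
Proof.
have coefE r n : ((fib r.+2)%:R * elem_sym r (S_ int)) n =
    \sum_(u <- separated_parts n | size u == r)
      (fib (size u).+2)%:R * (\prod_(j <- u) S_ int j) n.
  rewrite mulr_natl fps_coefMn coef_elem_sym_S -mulr_natl mulr_sumr.
  by apply: eq_bigr => u /eqP ->.
(* In degree n, only the finitely many sizes found in [separated_parts n] contribute. *)
have out r n : r \notin [fset size u | u in separated_parts n]%fset ->
    ((fib r.+2)%:R * elem_sym r (S_ int)) n = 0.
  move=> rP; rewrite coefE big_seq_cond big_pred0// => u.
  by apply/andP => -[uP /eqP ur]; move/negP: rP; apply; apply/imfsetP; exists u.
split=> [r n|n|].
- apply: (@sub_finite_set _ _ (@tval r nat @^-1` [set` separated_parts n])).
    move=> t /= [ti]; rewrite elem_sym_termE; apply: contra_neqT.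
    exact: coef_prod_S_eq0.
  by apply: finite_preimage => // x y _ _; exact: val_inj.
- apply: (@sub_finite_set _ _ [set` [fset size u | u in separated_parts n]%fset]) => //.
  by move=> r /= [_]; apply: contra_neqT; exact: out.
- apply: fpsP => n; rewrite [LHS]num_separatedE.
  rewrite [RHS](@fsbigTE _ _ _ _ [fset size u | u in separated_parts n]%fset).
    (* Grouping the sum of [num_separatedE] by size yields the sum over r. *)
    rewrite (partition_big_imfset _ (@size nat)); apply: eq_bigr => r _.
    by rewrite coefE.
  by move=> r; exact: out.
Qed.
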